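(* Let $P \subset \mathbb{R}^d$ be a lattice polytope of dimension $d$, and let $\operatorname{pyr}(P) \subset \mathbb{R}^{d+1}$ be its lattice pyramid. Then the following conditions are equivalent: (i) $P$ is normal; (ii) $\operatorname{pyr}(P)$ is normal; (iii) $\operatorname{pyr}(P)$ is very ample.
   Context: A lattice polytope is a convex polytope $P \subset \mathbb{R}^d$ each of whose vertices belongs to $\mathbb{Z}^d$. The lattice pyramid $\operatorname{pyr}(P) \subset \mathbb{R}^{d+1}$ of a lattice polytope $P \subset \mathbb{R}^d$ is the convex hull of $\{(\mathbf{a},0) \in \mathbb{R}^{d+1} : \mathbf{a} \in P\} \cup \{(0,\ldots,0,1)\}$. For an integer $N \geq 1$ put $NP = \{N\mathbf{a} : \mathbf{a} \in P\}$. A lattice polytope $P \subset \mathbb{R}^d$ is normal if for each integer $N \geq 1$ and each $\mathbf{a} \in NP \cap \mathbb{Z}^d$ there exist $\mathbf{a}_1, \ldots, \mathbf{a}_N \in P \cap \mathbb{Z}^d$ with $\mathbf{a} = \mathbf{a}_1 + \cdots + \mathbf{a}_N$. It is very ample if the same holds for all sufficiently large $N$, i.e. there is $N_0$ such that for each $N \geq N_0$ and each $\mathbf{a} \in NP \cap \mathbb{Z}^d$ there exist $\mathbf{a}_1, \ldots, \mathbf{a}_N \in P \cap \mathbb{Z}^d$ with $\mathbf{a} = \mathbf{a}_1 + \cdots + \mathbf{a}_N$. *)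

(* Defs.v *)
From HB Require Import structures.
From mathcomp Require Import all_boot all_order all_algebra.
From mathcomp Require Import all_classical all_reals all_analysis.

Set Implicit Arguments.
Unset Strict Implicit.
Unset Printing Implicit Defensive.

Import Order.TTheory GRing.Theory Num.Theory.
Local Open Scope classical_set_scope.
Local Open Scope ring_scope.

Section LatticePolytopes.
Variable R : realType.

Definition convex_hull (d : nat) (A : set 'rV[R]_d) : set 'rV[R]_d :=
  smallest (@convex_set R 'rV[R]_d) A.

Definition polytope (d : nat) (P : set 'rV[R]_d) : Prop :=
  exists2 V : set 'rV[R]_d, finite_set V & P = convex_hull V.

(* A vertex is a zero-dimensional face: the point [v] is the face of [P] on
   which the linear functional [x |-> x *m c] attains its maximum. *)
Definition vertex (d : nat) (P : set 'rV[R]_d) (v : 'rV[R]_d) : Prop :=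
  P v /\ exists c : 'cV[R]_d,
    forall x, P x -> x != v -> (x *m c) 0 0 < (v *m c) 0 0.

Definition lattice (d : nat) : set 'rV[R]_d :=
  [set x | forall i, x 0 i \is a Num.int].

Definition lattice_polytope (d : nat) (P : set 'rV[R]_d) : Prop :=
  polytope P /\ vertex P `<=` @lattice d.

Definition affine_hull (d : nat) (A : set 'rV[R]_d) : set 'rV[R]_d :=
  [set x | exists (n : nat) (a : 'I_n -> 'rV[R]_d) (t : 'I_n -> R),
     [/\ forall i, A (a i), \sum_(i < n) t i = 1
       & x = \sum_(i < n) t i *: a i]].

(* [A] has dimension [k]: its affine hull is a translate of a [k]-dimensional
   linear subspace. In particular [A] is then nonempty. *)
Definition has_dimension (d : nat) (A : set 'rV[R]_d) (k : nat) : Prop :=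
  exists (x0 : 'rV[R]_d) (W : {vspace 'rV[R]_d}),
    \dim W = k /\ affine_hull A = [set x0 + w | w in [set w | w \in W]].

Definition pyr (d : nat) (P : set 'rV[R]_d) : set 'rV[R]_(d + 1) :=
  convex_hull ([set row_mx a (0 : 'rV[R]_1) | a in P]
               `|` [set row_mx (0 : 'rV[R]_d) (1%:M : 'rV[R]_1)]).

Definition dilate (d N : nat) (P : set 'rV[R]_d) : set 'rV[R]_d :=
  [set N%:R *: a | a in P].

Definition decomposes_at (d : nat) (P : set 'rV[R]_d) (N : nat) : Prop :=
  forall a, (dilate N P `&` @lattice d) a ->
    exists b : 'I_N -> 'rV[R]_d,
      (forall i, (P `&` @lattice d) (b i)) /\ a = \sum_(i < N) b i.

Definition normal_polytope (d : nat) (P : set 'rV[R]_d) : Prop :=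
  forall N, (1 <= N)%N -> decomposes_at P N.

Definition very_ample (d : nat) (P : set 'rV[R]_d) : Prop :=
  exists N0, forall N, (1 <= N)%N -> (N0 <= N)%N -> decomposes_at P N.

End LatticePolytopes.

(* Main.v *)
Require Import Defs.
From mathcomp Require Import all_boot all_order all_algebra.
From mathcomp Require Import all_classical all_reals all_analysis.
From mathcomp Require Import lra.

(** A point of [pyr P] has the form [((1 - t) a, t)] with [a] in [P] and
    [0 <= t <= 1], so its lattice points are the apex and the [(a, 0)] with [a]
    a lattice point of [P]. A lattice point of [N pyr(P)] at height [k] thus
    lies over a lattice point of [(N - k) P], and is decomposed by adding [k]
    copies of the apex to a decomposition of the latter. Conversely, if
    [pyr P] decomposes at [N + N0] and [x] is a lattice point of [N P], then the
    height of [(x, N0)] counts the apices in its decomposition; the other [N]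
    summands decompose [x]. *)

Set Implicit Arguments.
Unset Strict Implicit.
Unset Printing Implicit Defensive.

Import Order.TTheory GRing.Theory Num.Theory.
Local Open Scope classical_set_scope.
Local Open Scope ring_scope.

Section Pyramid.
Variable R : realType.

(** Trades the interval-typed coefficient of [convex_set] for two plain weights of sum 1, a form
    open to linear arithmetic. *)
Lemma convex_setP (d : nat) (A : set 'rV[R]_d) :
  convex_set A <->
  forall x y p q, A x -> A y -> 0 <= p -> 0 <= q -> p + q = 1 ->
    A (p *: x + q *: y).
Proof.
split=> [cA x y p q Ax Ay p0 q0 pq|cA x y l].
  have p01 : Itv.spec (@Itv.num_sem R) (Itv.Real `[0%Z, 1%Z]) p.
    rewrite /= /Itv.num_sem /= in_itv /= p0 num_real /=; lra.
  have := cA x y (Itv.mk p01); rewrite !inE => /(_ Ax Ay).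
  rewrite /conv /= /unstable.onem.
  by have -> : q = 1 - p by lra.
rewrite !inE => Ax Ay.
have l0 : 0 <= l%:num by [].
have l1 : l%:num <= 1 by [].
by apply: (cA x y l%:num (1 - l%:num)) => //; lra.
Qed.

Lemma convex_convex_hull (d : nat) (A : set 'rV[R]_d) :
  convex_set (convex_hull A).
Proof.
apply/convex_setP => x y p q Ax Ay p0 q0 pq B [cB AB].
by move/convex_setP: (cB); apply=> //; [apply: Ax | apply: Ay].
Qed.

(** The base point [x0] lies in the affine hull, and coefficients of sum 1 cannot form an empty
    family. *)
Lemma has_dimension_nonempty (d k : nat) (A : set 'rV[R]_d) :
  has_dimension A k -> A !=set0.
Proof.
move=> [x0 [W [_ eqA]]].
have : affine_hull A x0 by rewrite eqA; exists 0; [exact: mem0v | rewrite addr0].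
case=> -[|n] [a [t [Aa t1 _]]]; last by exists (a ord0).
by move/eqP: t1; rewrite big_ord0 eq_sym oner_eq0.
Qed.

Lemma lattice_row_mx (d : nat) (a : 'rV[R]_d) (c : R) :
  @lattice R (d + 1) (row_mx a c%:M) <-> @lattice R d a /\ c \is a Num.int.
Proof.
split=> [Lac|[La Lc] i].
  split=> [i|]; first by rewrite -(row_mxEl a (c%:M : 'M[R]_1)).
  by have := Lac (rshift d ord0); rewrite row_mxEr mxE.
by case: (split_ordP i) => j ->; rewrite ?row_mxEl ?row_mxEr // ord1 mxE.
Qed.

Lemma scale_height (a c : R) : a *: c%:M = (a * c)%:M :> 'M[R]_1.
Proof. by rewrite scale_scalar_mx. Qed.

Lemma pyr_apex (d : nat) (P : set 'rV[R]_d) : pyr P (row_mx 0 1%:M).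
Proof. by apply: sub_gen_smallest; right. Qed.

Lemma pyr_base (d : nat) (P : set 'rV[R]_d) (a : 'rV[R]_d) :
  P a -> pyr P (row_mx a 0).
Proof. by move=> Pa; apply: sub_gen_smallest; left; exists a. Qed.

Lemma mem_pyr (d : nat) (P : set 'rV[R]_d) (a : 'rV[R]_d) (t : R) :
  P a -> 0 <= t <= 1 -> pyr P (row_mx ((1 - t) *: a) t%:M).
Proof.
move=> Pa /andP[t0 t1].
have /convex_setP cpyr : convex_set (pyr P) by exact: convex_convex_hull.
have := cpyr _ _ (1 - t) t (pyr_base Pa) (@pyr_apex d P).
rewrite !scale_row_mx add_row_mx !scaler0 add0r addr0 scale_height mulr1.
by apply; lra.
Qed.

(** The points of this form are a convex set containing the base and the apex, hence the whole hull.
    At the apex [t = 1], and any point of [P] can serve as [a]. *)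
Lemma pyrP (d : nat) (P : set 'rV[R]_d) : convex_set P -> P !=set0 ->
  forall x, pyr P x ->
    exists a t, [/\ P a, 0 <= t <= 1 & x = row_mx ((1 - t) *: a) t%:M].
Proof.
move=> /convex_setP cP [a0 Pa0] x.
apply: (@smallest_sub _ _ _
  [set x | exists a t, [/\ P a, 0 <= t <= 1 & x = row_mx ((1 - t) *: a) t%:M]]).
- apply/convex_setP => _ _ p q
    [a [t [Pa /andP[t0 t1] ->]]] [b [s [Pb /andP[s0 s1] ->]]] p0 q0 pq.
  rewrite !scale_row_mx add_row_mx !scale_height -raddfD /=.
  set u := p * t + q * s.
  have u0 : 0 <= u by rewrite addr_ge0 ?mulr_ge0.
  have u1 : 1 - u = p * (1 - t) + q * (1 - s) by rewrite /u; lra.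
  have pt0 : 0 <= p * (1 - t) by rewrite mulr_ge0 ?subr_ge0.
  have qs0 : 0 <= q * (1 - s) by rewrite mulr_ge0 ?subr_ge0.
  (* At height 1 both base weights vanish. Below it, dividing them by [1 - u] makes them the weights
     of a convex combination in [P]. *)
  have [u1E|u1N] := eqVneq (1 - u) 0.
    exists a, u; split=> //; first by lra.
    have ptE : p * (1 - t) = 0 by lra.
    have qsE : q * (1 - s) = 0 by lra.
    by rewrite !scalerA ptE qsE u1E !scale0r addr0.
  exists ((p * (1 - t) / (1 - u)) *: a + (q * (1 - s) / (1 - u)) *: b), u.
  split; last 2 first.
  + lra.
  + by rewrite scalerDr !scalerA ![(1 - u) * _]mulrC !divfK.
  + apply: cP => //; rewrite ?divr_ge0 //; try lra.
    by rewrite -mulrDl -u1 divff.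
- move=> _ [[a Pa <-]|->].
    by exists a, 0; split; rewrite ?lexx ?ler01 // subr0 scale1r raddf0.
  by exists a0, 1; split; rewrite ?lexx ?ler01 // subrr scale0r.
Qed.

Lemma int_ge0_le_nat (x : R) (N : nat) :
  x \is a Num.int -> 0 <= x <= N%:R -> exists2 k : nat, (k <= N)%N & x = k%:R.
Proof.
move=> xint /andP[x0]; move: xint; rewrite Num.Theory.intrEge0 //.
by move=> /natrP[k ->]; rewrite ler_nat; exists k.
Qed.

Lemma pyr_latticeP (d : nat) (P : set 'rV[R]_d) : convex_set P -> P !=set0 ->
  forall x, (pyr P `&` @lattice R (d + 1)) x ->
    (exists2 a, (P `&` @lattice R d) a & x = row_mx a 0) \/ x = row_mx 0 1%:M.
Proof.
move=> cP P0 x [/(pyrP cP P0)[a [t [Pa t01 ->]]] /lattice_row_mx[La Lt]].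
(* An integral height in [0, 1] is 0 or 1. *)
have [[|[|//]] _ tE] := int_ge0_le_nat (N := 1) Lt t01; rewrite {}tE in La *.
  by left; exists a; rewrite subr0 scale1r ?raddf0 // in La *.
by right; rewrite subrr scale0r.
Qed.

Lemma normal_pyr (d : nat) (P : set 'rV[R]_d) : convex_set P ->
  P !=set0 -> normal_polytope P -> normal_polytope (pyr P).
Proof.
move=> cP P0 nP N N1 _ [[_ /(pyrP cP P0)[a [t [Pa /andP[t0 t1] ->]]] <-]].
rewrite scale_row_mx scale_height => /lattice_row_mx[La Lt].
have [k kN tE] : exists2 k : nat, (k <= N)%N & N%:R * t = k%:R.
  by apply: int_ge0_le_nat => //; rewrite mulr_ge0 //= ler_piMr.
have aE : N%:R *: ((1 - t) *: a) = (N - k)%:R *: a.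
  by rewrite scalerA mulrBr mulr1 tE natrB.
rewrite {}aE in La *; rewrite {}tE in Lt *.
(* With [N] written as [n + k], the indices split into [n] for base points and [k] for copies of the
   apex. *)
rewrite -(subnK kN) in N1 *; move: (N - k)%N N1 La => n _ La {N kN Lt}.
rewrite addnK.
have [b [Pb ->]] : exists b : 'I_n -> 'rV[R]_d,
    (forall i, (P `&` @lattice R d) (b i)) /\ n%:R *: a = \sum_(i < n) b i.
  (* Normality covers only positive dilations; for [n = 0] the empty sum gives the zero vector. *)
  case: n La => [|n] La; last by apply: nP => //; split=> //; exists a.
  by exists (fun=> 0); split=> [[]|]; rewrite // big_ord0 scale0r.
exists (fun i => match fintype.split i with
                 | inl j => row_mx (b j) 0 | inr _ => row_mx 0 1%:M end).
split=> [i|].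
  case: (fintype.split i) => [j|_].
    have [Pbj Lbj] := Pb j; split; first exact: pyr_base.
    by rewrite -(raddf0 (@scalar_mx R 1)); apply/lattice_row_mx; rewrite rpred0.
  split; first exact: pyr_apex.
  by apply/lattice_row_mx; split=> [j|]; rewrite ?rpred1 // mxE rpred0.
rewrite big_split_ord /=.
under [X in _ = X + _]eq_bigr => i _ do
  rewrite (unsplitK (inl i) : fintype.split (lshift k i) = _).
under [X in _ = _ + X]eq_bigr => i _ do
  rewrite (unsplitK (inr i) : fintype.split (rshift n i) = _).
have -> : \sum_(i < k) row_mx (0 : 'rV[R]_d) (1%:M : 'M[R]_1) =
    row_mx 0 k%:R%:M.
  by rewrite sumr_const card_ord -scaler_nat scale_row_mx scaler0 scale_height
    mulr1.
have -> : \sum_(i < n) row_mx (b i) (0 : 'M[R]_1) = row_mx (\sum_(i < n) b i) 0.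
  by elim/big_rec2: _ => [|i x y _ ->]; rewrite ?row_mx0 // add_row_mx addr0.
by rewrite add_row_mx add0r addr0.
Qed.

(** Reindexes the summands selected by [A] along ['I_N], the shape that [decomposes_at] requires. *)
Lemma enum_summands (T : finType) (V : nmodType) (A : {set T}) (f : T -> V)
    (Q : V -> Prop) (N : nat) :
  #|A| = N -> (forall i, i \in A -> Q (f i)) ->
  exists b : 'I_N -> V,
    (forall j, Q (b j)) /\ \sum_(i in A) f i = \sum_(j < N) b j.
Proof.
move=> <- QA; exists (fun j => f (enum_val j)).
by split=> [j|]; [exact: QA (enum_valP j) | rewrite big_enum_val].
Qed.

Lemma pyr_decomposes_at (d : nat) (P : set 'rV[R]_d) (N N0 : nat) :
  convex_set P -> P !=set0 -> (0 < N)%N ->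
  decomposes_at (pyr P) (N + N0) -> decomposes_at P N.
Proof.
move=> cP P0 N1 dP _ [[a Pa <-] La].
have M0 : (N + N0)%:R != 0 :> R by rewrite pnatr_eq0 -lt0n addn_gt0 N1.
have Mx : (dilate (N + N0) (pyr P) `&` @lattice R (d + 1))
    (row_mx (N%:R *: a) N0%:R%:M).
  split; last by apply/lattice_row_mx; rewrite ?Num.Theory.intr_nat ?natr_nat.
  (* The height [t = N0 / (N + N0)] is chosen so that scaling by [N + N0] turns [t] into [N0] and
     [1 - t] into [N]. *)
  exists (row_mx ((1 - N0%:R / (N + N0)%:R) *: a) (N0%:R / (N + N0)%:R)%:M).
    apply: mem_pyr => //; rewrite divr_ge0 //= ler_pdivrMr ?lt0r ?M0 ?ler0n //.
    by rewrite mul1r ler_nat leq_addl.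
  rewrite scale_row_mx scale_height scalerA mulrBr mulr1 mulrCA divff // mulr1.
  by rewrite natrD addrK.
(* [A] collects the indices of the summands in the base; all others are the apex. *)
have [b [Pb]] := dP _ Mx; set A := [set i | rsubmx (b i) == 0]%SET.
have bA i : i \in A -> (P `&` @lattice R d) (lsubmx (b i)).
  rewrite inE; have [[c Pc ->]|->] := pyr_latticeP cP P0 (Pb i).
    by rewrite row_mxKl.
  by rewrite row_mxKr => /eqP/rowP/(_ ord0)/eqP; rewrite !mxE oner_eq0.
have bNA i : i \notin A -> b i = row_mx 0 1%:M.
  rewrite inE; have [[c Pc ->]|//] := pyr_latticeP cP P0 (Pb i).
  by rewrite row_mxKr eqxx.
move=> bE.
have /rowP/(_ ord0) : rsubmx (row_mx (N%:R *: a) N0%:R%:M) =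
    \sum_(i < N + N0) rsubmx (b i) by rewrite bE raddf_sum.
have -> : N%:R *: a = \sum_(i in A) lsubmx (b i).
  rewrite -[LHS](row_mxKl _ (N0%:R%:M : 'M[R]_1)) bE raddf_sum (bigID (mem A)) /=.
  rewrite [X in _ + X]big1 ?addr0 // => i /bNA ->; exact: row_mxKl.
(* In the last coordinate base summands contribute 0 and each apex 1, so the complement of [A] has
   [N0] elements and [A] has [N]. *)
rewrite row_mxKr (bigID (mem A)) /= big1 ?add0r => [|i]; last first.
  by rewrite inE => /eqP.
under eq_bigr => i /bNA -> do rewrite row_mxKr.
rewrite sumr_const mulmxnE !mxE /= => /eqP; rewrite eqr_nat => /eqP cN0.
have cA : #|A| = N.
  have := cardC (mem A); rewrite card_ord /= => cE.
  by apply: (@addIn N0); rewrite -[RHS]cE; congr addn.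
exact: (enum_summands cA bA).
Qed.

End Pyramid.

Theorem proposition3p3 (R : realType) (d : nat) (P : set 'rV[R]_d)
    (latticeP : lattice_polytope P) (dimP : has_dimension P d) :
  [<-> normal_polytope P; normal_polytope (pyr P); very_ample (pyr P)].
Proof.
have P0 := has_dimension_nonempty dimP.
have [[V _ PE] _] := latticeP.
have cP : convex_set P by rewrite PE; exact: convex_convex_hull.
tfae.
- exact: normal_pyr.
- by move=> nP; exists 0%N => N N1 _; exact: nP.
(* Adding the threshold [N0] itself as the number of apices puts [N + N0] in the very ample range
   for every [N]. *)
- move=> [N0 aP] N N1; apply: (pyr_decomposes_at cP P0 N1 (N0 := N0)).
  by apply: aP; rewrite ?addn_gt0 ?N1 ?leq_addl.
Qed.
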